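(* Let $\gamma_- < \gamma_+$ be real constants, let $f$ be a function, not identically zero, that is $C^1$ on $[\gamma_-,\gamma_+]$ and satisfies $f(\gamma_-)=f(\gamma_+)=0$, and suppose the initial datum satisfies $\gamma_-\le \phi_0\le \gamma_+$. Suppose the time step $\Delta t>0$ satisfies $$\Delta t \max_{\gamma_-\le u\le \gamma_+} f'(u)\le 1 .$$ Let $(\phi_j^n)_{1\le j\le J,\ n\ge 0}$ be the solution of the semi-implicit scheme $$\frac{\phi_j^{n+1}-\phi_j^n}{\Delta t}=\varepsilon^2\nabla_+\nabla_-\phi_j^{n+1}-f(\phi_j^n),\qquad 1\le j\le J,\ n\ge 0,$$ with periodic boundary conditions and initial values $\phi_j^0=\phi_0(x_j)$. Then $$\gamma_-\le \phi_j^n\le \gamma_+\qquad\text{for all } 1\le j\le J \text{ and all } n\ge 0 .$$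
   Context: The scheme discretizes the Allen-Cahn equation $\partial_t\phi=\varepsilon^2\Delta\phi-f(\phi)$, $\phi(x,0)=\phi_0(x)$, in one space dimension. Here $\varepsilon>0$ is a constant, $J\ge 1$ is the number of spatial grid points $x_1,\dots,x_J$ of a uniform grid with mesh size $\Delta x>0$, and $\Delta t>0$ is the time step; all quantities are real. The difference operators are $$\nabla_+u_j=\frac{u_{j+1}-u_j}{\Delta x},\qquad \nabla_-u_j=\frac{u_j-u_{j-1}}{\Delta x}.$$ Periodic boundary conditions mean that indices are understood modulo $J$, i.e. $\phi_0^n=\phi_J^n$ and $\phi_{J+1}^n=\phi_1^n$ (here $\phi_0^n$ is the grid value with index $0$, not the initial function $\phi_0$). The derivatives of $f$ at the endpoints of $[\gamma_-,\gamma_+]$ are one-sided if $f$ is defined only on that interval; values of $f$ outside the interval play no role in the hypotheses. *)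

(* Defs.v *)
From HB Require Import structures.
From mathcomp Require Import all_boot all_order all_algebra.
From mathcomp Require Import all_classical all_reals all_analysis.

Set Implicit Arguments.
Unset Strict Implicit.
Unset Printing Implicit Defensive.

Import Order.TTheory GRing.Theory Num.Theory.
Import numFieldNormedType.Exports.

Local Open Scope classical_set_scope.
Local Open Scope ring_scope.

(* Differentiability relative to [a, b]: the difference quotient only uses
   points of [a, b], so it is two-sided inside and one-sided at a and b, and
   values of f outside [a, b] are irrelevant. *)
Definition derivable_cc (R : realType) (f : R -> R) (a b x : R) : Prop :=
  cvg ((f y - f x) / (y - x) @[y --> within `[a, b] x^']).

Definition derive_cc (R : realType) (f : R -> R) (a b x : R) : R :=
  lim ((f y - f x) / (y - x) @[y --> within `[a, b] x^']).

Definition C1_cc (R : realType) (f : R -> R) (a b : R) : Prop :=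
  (forall x, x \in `[a, b]%R -> derivable_cc f a b x) /\
  {within `[a, b], continuous (derive_cc f a b)}.

Definition max_derive_cc (R : realType) (f : R -> R) (a b : R) : R :=
  sup (derive_cc f a b @` `[a, b]).

(* The supremum above is a genuine maximum. *)
Lemma max_derive_ccP (R : realType) (f : R -> R) (a b : R) :
  a <= b -> C1_cc f a b ->
  (exists2 c, c \in `[a, b]%R & max_derive_cc f a b = derive_cc f a b c) /\
  (forall u, u \in `[a, b]%R -> derive_cc f a b u <= max_derive_cc f a b).
Proof.
move=> ab [_ cf]; have [c cab cmax] := EVT_max ab cf.
have -> : max_derive_cc f a b = derive_cc f a b c; last by split; first by exists c.
apply/eqP; rewrite eq_le; apply/andP; split.
  apply: ge_sup; first by exists (derive_cc f a b c), c.
  by move=> _ [u /= uab <-]; exact: cmax.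
apply: ub_le_sup; last by exists c.
by exists (derive_cc f a b c) => _ [u /= uab <-]; exact: cmax.
Qed.

(* Periodic grid functions are indexed by 'I_J, index j standing for the grid
   point x_(j+1); ordS and ord_pred are the successor and the predecessor
   modulo J. *)
Definition grid_point (R : realType) (J : nat) (x1 dx : R) (j : 'I_J) : R :=
  x1 + j%:R * dx.

Definition nabla_plus (R : realType) (J : nat) (dx : R) (u : 'I_J -> R) :
    'I_J -> R :=
  fun j => (u (ordS j) - u j) / dx.

Definition nabla_minus (R : realType) (J : nat) (dx : R) (u : 'I_J -> R) :
    'I_J -> R :=
  fun j => (u j - u (ord_pred j)) / dx.

Definition semi_implicit_scheme (R : realType) (J : nat) (eps dx dt : R)
    (f : R -> R) (phi : nat -> 'I_J -> R) : Prop :=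
  forall (n : nat) (j : 'I_J),
    (phi n.+1 j - phi n j) / dt =
    eps ^+ 2 * nabla_plus dx (nabla_minus dx (phi n.+1)) j - f (phi n j).

(* Main.v *)
Require Import Defs.
From HB Require Import structures.
From mathcomp Require Import all_boot all_order all_algebra.
From mathcomp Require Import all_classical all_reals all_analysis.
From mathcomp Require Import lra.

Set Implicit Arguments.
Unset Strict Implicit.
Unset Printing Implicit Defensive.

Import Order.TTheory GRing.Theory Num.Theory.
Import numFieldNormedType.Exports.

Local Open Scope classical_set_scope.
Local Open Scope ring_scope.

(** The theorem is a maximum principle for one implicit diffusion step applied
    to the output of one explicit reaction step.

    Solving the scheme for the new values gives
    [v j = (w j - dt * f (w j)) + dt * eps^2 * (Laplacian of v at j)], where
    [w] and [v] are the old and new time levels.  At an index where [v] is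
    maximal the periodic discrete Laplacian is nonpositive, so
    [max v <= max (w - dt * f w)]; dually for the minimum
    ([implicit_diffusion_bounds]).

    What remains is that the reaction map [u |-> u - dt * f u] sends
    [[gm, gp]] to itself.  It fixes [gm] and [gp], since [f] vanishes there,
    and by the mean value theorem [f v - f u <= M * (v - u)] with [M] the
    maximum of [f'], so the hypothesis [dt * M <= 1] makes the map
    nondecreasing ([explicit_step_nondecreasing]). *)

(** * One-sided derivatives and the mean value theorem *)

(** The difference quotient tends to a finite limit while [y - x] tends to 0,
    so their product [f y - f x] tends to 0, including at the endpoints. *)
Lemma derivable_cc_continuous (R : realType) (f : R -> R) (a b : R) :
  (forall x, x \in `[a, b]%R -> derivable_cc f a b x) ->
  {within `[a, b], continuous f}.
Proof.
move=> df; apply/subspace_continuousP => x xab.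
have /cvg_ex[/= l ql] : derivable_cc f a b x by exact: df.
have yx : (y - x) @[y --> within `[a, b] x^'] --> (0 : R).
  rewrite -(subrr x); apply: cvgB; last exact: cvg_cst.
  by apply: cvg_trans (@nbhs_dnbhs _ x); exact: cvg_within.
have prod : (f y - f x) / (y - x) * (y - x) @[y --> within `[a, b] x^']
    --> (0 : R) by rewrite -(mulr0 l); exact: cvgM.
apply/cvgrPdist_lt => e e0.
move/cvgrPdist_lt : prod => /(_ _ e0) prod_lt.
(* The deleted relative neighbourhood, unfolded over neighbourhoods of [x];
   the excluded point [y = x] is trivial for continuity. *)
have {}prod_lt : \forall y \near x, y != x -> [set` `[a, b]] y ->
  `|0 - (f y - f x) / (y - x) * (y - x)| < e by [].
apply: filterS prod_lt => y + yab.
have [->|yNx] := eqVneq y x; first by rewrite subrr normr0.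
by move=> /(_ isT yab); rewrite divfK ?subr_eq0// sub0r opprB.
Qed.

(** A neighbourhood of an interior point lies in [[a, b]], so there the
    relative derivative is the ordinary one. *)
Lemma is_derive_derive_cc (R : realType) (f : R -> R) (a b x : R) :
  x \in `]a, b[%R -> derivable_cc f a b x ->
  is_derive x 1 f (derive_cc f a b x).
Proof.
move=> xab df.
have shift : (h *: 1 + x) @[h --> 0^'] --> within `[a, b] x^'.
  have xh : (h *: 1 + x) @[h --> (0 : R)] --> x.
    rewrite -[X in _ --> X]add0r -[X in _ --> X + _](scale0r (1 : R)).
    by apply: cvgD; [exact: cvgZr_tmp cvg_id|exact: cvg_cst].
  move=> P xP.
  have {}xP : \forall y \near x, y != x -> [set` `[a, b]] y -> P y by [].
  have hP : \forall h \near (0 : R), (h *: 1 + x != x ->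
      [set` `[a, b]] (h *: 1 + x) -> P (h *: 1 + x)) /\ h *: 1 + x \in `]a, b[.
    exact: xh _ (filterI xP (near_in_itvoo xab)).
  have : \forall h \near (0 : R), h != 0 -> P (h *: 1 + x).
    apply: filterS hP => h [Ph /subset_itv_oo_cc hab] h0.
    by apply: Ph => //; rewrite -subr_eq0 addrK [_ *: 1]mulr1.
  by [].
have quot : h^-1 *: (f (h *: 1 + x) - f x) @[h --> 0^'] --> derive_cc f a b x.
  have := cvg_comp _ _ shift df.
  apply: cvg_trans; apply: near_eq_cvg; apply: nearW => h.
  by rewrite /= addrK scaler1 mulrC.
split; first by apply/cvg_ex; exists (derive_cc f a b x).
exact: cvg_lim quot.
Qed.

(** On [[u, v]], possibly sharing endpoints with [[a, b]], the mean value
    theorem asks for an ordinary derivative only inside, which is why the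
    one-sided derivatives at [a] and [b] suffice. *)
Lemma sub_le_max_derive_cc (R : realType) (f : R -> R) (a b u v : R) :
  C1_cc f a b -> a <= u -> u <= v -> v <= b ->
  f v - f u <= max_derive_cc f a b * (v - u).
Proof.
move=> fC1 au; rewrite le_eqVlt => /predU1P[->|uv] vb.
  by rewrite !subrr mulr0.
have [df _] := fC1.
have ab : a <= b by lra.
have cf : {within `[u, v], continuous f}.
  apply: (continuous_subspaceW _ (derivable_cc_continuous df)).
  by apply: subset_itv; rewrite bnd_simp.
have df' x : x \in `]u, v[%R -> is_derive x 1 f (derive_cc f a b x).
  rewrite in_itv/= => /andP[ux xv]; apply: is_derive_derive_cc.
    by rewrite in_itv/=; apply/andP; split; lra.
  by apply: df; rewrite in_itv/=; apply/andP; split; lra.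
have [c + ->] := MVT uv df' cf.
rewrite in_itv/= => /andP[uc cv]; apply: ler_wpM2r; first lra.
by apply: (max_derive_ccP ab fC1).2; rewrite in_itv/=; apply/andP; split; lra.
Qed.

(** The increment of the map on [[u, v]] is at least
    [(1 - dt * M) * (v - u)], where [M] is the maximum of the derivative. *)
Lemma explicit_step_nondecreasing (R : realType) (f : R -> R) (a b dt u v : R) :
  C1_cc f a b -> 0 <= dt -> dt * max_derive_cc f a b <= 1 ->
  a <= u -> u <= v -> v <= b ->
  u - dt * f u <= v - dt * f v.
Proof.
move=> fC1 dt0 step au uv vb.
have := ler_wpM2l dt0 (sub_le_max_derive_cc fC1 au uv vb).
have : dt * max_derive_cc f a b * (v - u) <= 1 * (v - u).
  by apply: ler_wpM2r => //; lra.
lra.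
Qed.

(** * The periodic discrete Laplacian at an extremum *)

Lemma nabla_plus_minusE (R : realType) (J : nat) (dx : R) (u : 'I_J -> R) j :
  nabla_plus dx (nabla_minus dx u) j =
  ((u (ordS j) - u j) + (u (ord_pred j) - u j)) / dx ^+ 2.
Proof.
rewrite /nabla_plus /nabla_minus ordSK -mulrBl -mulrA -invfM -expr2.
by rewrite opprB addrA -addrA.
Qed.

Lemma laplacian_le0_at_max (R : realType) (J : nat) (dx : R) (u : 'I_J -> R) j :
  (forall i, u i <= u j) -> nabla_plus dx (nabla_minus dx u) j <= 0.
Proof.
move=> uj; rewrite nabla_plus_minusE mulr_le0_ge0 ?invr_ge0 ?sqr_ge0//.
by have := uj (ordS j); have := uj (ord_pred j); lra.
Qed.

Lemma laplacian_ge0_at_min (R : realType) (J : nat) (dx : R) (u : 'I_J -> R) j :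
  (forall i, u j <= u i) -> 0 <= nabla_plus dx (nabla_minus dx u) j.
Proof.
move=> uj; rewrite nabla_plus_minusE mulr_ge0 ?invr_ge0 ?sqr_ge0//.
by have := uj (ordS j); have := uj (ord_pred j); lra.
Qed.

(** Bounds on the right-hand side of the implicit equation
    [v - k * Laplacian v = r] pass to its solution: it suffices to compare at
    an index where [v] is extremal. *)
Lemma implicit_diffusion_bounds (R : realType) (J : nat) (dx k m M : R)
    (r v : 'I_J -> R) :
  0 <= k ->
  (forall j, v j = r j + k * nabla_plus dx (nabla_minus dx v) j) ->
  (forall j, m <= r j <= M) -> forall j, m <= v j <= M.
Proof.
move=> k0 vE rmM j; apply/andP; split.
  have [i _ vi] := arg_minP v (isT : xpredT j).
  apply: le_trans (vi j isT); rewrite vE.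
  have /andP[mr _] := rmM i.
  by rewrite ler_wpDr// mulr_ge0// laplacian_ge0_at_min// => l; exact: vi.
have [i _ vi] := arg_maxP v (isT : xpredT j).
apply: le_trans (vi j isT) _; rewrite vE.
have /andP[_ rM] := rmM i.
by rewrite ler_wnDr// mulr_ge0_le0// laplacian_le0_at_max// => l; exact: vi.
Qed.

(** * The scheme *)

Theorem theorem2p1 (R : realType) (gm gp : R) (hg : gm < gp)
  (f : R -> R)
  (hf0 : exists2 u, u \in `[gm, gp]%R & f u != 0)
  (hf1 : C1_cc f gm gp)
  (hfm : f gm = 0) (hfp : f gp = 0)
  (Omega : set R) (phi0 : R -> R)
  (hphi0 : forall x, Omega x -> gm <= phi0 x <= gp)
  (J : nat) (hJ : (1 <= J)%N)
  (eps dx dt x1 : R) (heps : 0 < eps) (hdx : 0 < dx) (hdt : 0 < dt)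
  (hgrid : forall j : 'I_J, Omega (grid_point x1 dx j))
  (hstep : dt * max_derive_cc f gm gp <= 1)
  (phi : nat -> 'I_J -> R)
  (hinit : forall j : 'I_J, phi 0%N j = phi0 (grid_point x1 dx j))
  (hscheme : semi_implicit_scheme eps dx dt f phi) :
  forall (n : nat) (j : 'I_J), gm <= phi n j <= gp.
Proof.
elim=> [j|n IHn]; first by rewrite hinit; exact/hphi0/hgrid.
apply: (@implicit_diffusion_bounds R J dx (dt * eps ^+ 2) gm gp
         (fun j => phi n j - dt * f (phi n j))).
- by rewrite mulr_ge0 ?sqr_ge0// ltW.
- move=> j; have /(congr1 ( *%R^~ dt)) := hscheme n j.
  rewrite divfK ?gt_eqF//; lra.
(* Monotonicity compares the reaction step at [phi n j] with its values at
   the fixed points [gm] and [gp]. *)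
- move=> j; have /andP[gmw wgp] := IHn j.
  have dt0 : 0 <= dt by exact: ltW.
  have := explicit_step_nondecreasing hf1 dt0 hstep (lexx gm) gmw wgp.
  have := explicit_step_nondecreasing hf1 dt0 hstep gmw wgp (lexx gp).
  by rewrite hfm hfp mulr0 !subr0 => -> ->.
Qed.
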